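(* Let $P$ and $Q$ be Interface Automata and $p\in P$, $q\in Q$. (a) If $P$ and $Q$ have common input and output alphabets and disjoint state sets, then the MIA-conjunction state $[\![p]\!]\wedge[\![q]\!]$ of $[\![P]\!]\wedge[\![Q]\!]$ is defined and $[\![p]\!]\wedge[\![q]\!]=_{\mathrm{MIA}}[\![p\wedge q]\!]$, where $p\wedge q$ is the state of the IA-conjunction $P\wedge Q$. (b) If $P$ and $Q$ are composable and $p$, $q$ are compatible (as IAs), then $[\![p]\!]$ and $[\![q]\!]$ are compatible (as MIAs) and $[\![p]\!]\,|\,[\![q]\!]=_{\mathrm{MIA}}[\![p|q]\!]$.
   Context: IA: $P=(P,I,O,\rightarrow_P)$, states $P$, disjoint action sets $I,O$ not containing $\tau$, $\rightarrow_P\subseteq P\times(I\cup O\cup\{\tau\})\times P$ input-deterministic (for $a\in I$, $p\xrightarrow{a}p'$, $p\xrightarrow{a}p''$ imply $p'=p''$); $p\not\xrightarrow{a}$ means no $a$-transition. IA-conjunction $P\wedge Q$ (common alphabets, disjoint states): states $\{p\wedge q\}\cup P\cup Q$, least transition relation containing $\rightarrow_P,\rightarrow_Q$ with (I1) $p\wedge q\xrightarrow{a}p'$ if $p\xrightarrow{a}_Pp'$, $q\not\xrightarrow{a}_Q$, $a\in I$; (I2) $p\wedge q\xrightarrow{a}q'$ if $p\not\xrightarrow{a}_P$, $q\xrightarrow{a}_Qq'$, $a\in I$; (I3),(O) $p\wedge q\xrightarrow{a}p'\wedge q'$ if $p\xrightarrow{a}_Pp'$, $q\xrightarrow{a}_Qq'$,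 $a\in I\cup O$; (T1) $p\wedge q\xrightarrow{\tau}p'\wedge q$ if $p\xrightarrow{\tau}_Pp'$; (T2) $p\wedge q\xrightarrow{\tau}p\wedge q'$ if $q\xrightarrow{\tau}_Qq'$. IA parallel composition: with $A_j=I_j\cup O_j$, IAs $P_1,P_2$ are composable if $A_1\cap A_2=(I_1\cap O_2)\cup(O_1\cap I_2)$; product $P_1\otimes P_2$ has states $P_1\times P_2$, $I=(I_1\cup I_2)\setminus(O_1\cup O_2)$, $O=(O_1\cup O_2)\setminus(I_1\cup I_2)$, transitions (Par1) $(p_1,p_2)\xrightarrow{\alpha}(p_1',p_2)$ if $p_1\xrightarrow{\alpha}p_1'$, $\alpha\notin A_2$; (Par2) symmetric; (Par3) $(p_1,p_2)\xrightarrow{\tau}(p_1',p_2')$ if $p_1\xrightarrow{a}p_1'$, $p_2\xrightarrow{a}p_2'$. Error state: some $a\in A_1\cap A_2$ with $a\in O_1$, $p_1\xrightarrow{a}$, $p_2\not\xrightarrow{a}$, or $a\in O_2$, $p_2\xrightarrow{a}$, $p_1\not\xrightarrow{a}$. $E$: least set containing error states and states with an $\alpha$-transition ($\alpha\in O\cup\{\tau\}$) into $E$. $P_1|P_2$ removes $E$-states and transitions involving them; $p_1,p_2$ compatible iff $(p_1,p_2)\notin E$, written $p_1|p_2$. MIA: $(P,I,O,\longrightarrow_P,\dashrightarrow_P)$, $I,O$ disjoint, must $\subseteq P\times(I\cup O)\times(2^P\setminus\{\emptyset\})$, may $\subseteq P\times(I\cup O\cup\{\tau\})\times P$, syntactic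 consistency ($p\xrightarrow{a}P'$ implies $p\stackrel{a}{\dashrightarrow}p'$ for $p'\in P'$), and for $i\in I$: at most one $i$-must-transition per state, and $p\stackrel{i}{\dashrightarrow}p'$ implies $p\xrightarrow{i}P'$ with $p'\in P'$. Weak may: $p\stackrel{\epsilon}{\Longrightarrow}p'$ iff $p(\stackrel{\tau}{\dashrightarrow})^*p'$; $p\stackrel{\alpha}{\Longrightarrow}p'$ iff $\exists p''.\,p\stackrel{\epsilon}{\Longrightarrow}p''\stackrel{\alpha}{\dashrightarrow}p'$; $\hat\tau=\epsilon$, $\hat a=a$. $p\sqsubseteq_{\mathrm{MIA}}q$ iff some $\mathcal R$ containing $(p,q)$ satisfies: $q\xrightarrow{a}Q'$ implies some $p\xrightarrow{a}P'$ with $\forall p'\in P'\exists q'\in Q'.(p',q')\in\mathcal R$; $p\stackrel{\alpha}{\dashrightarrow}p'$ with $\alpha\in O\cup\{\tau\}$ implies some $q\stackrel{\hat\alpha}{\Longrightarrow}q'$ with $(p',q')\in\mathcal R$. $p=_{\mathrm{MIA}}q$ iff $p\sqsubseteq_{\mathrm{MIA}}q$ and $q\sqsubseteq_{\mathrm{MIA}}p$. MIA-conjunction: product $P\& Q$ on $(P\times Q)\cup P\cup Q$ inheriting transitions of $P,Q$, plus ($i\in I,o\in O,\alpha\in O\cup\{\tau\}$): (OMust1) $(p,q)\xrightarrow{o}\{(p',q'):p'\in P',q\stackrel{o}{\Longrightarrow}_Qq'\}$ if $p\xrightarrow{o}_PP'$, $q\stackrel{o}{\Longrightarrow}_Q$;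 (OMust2) symmetric; (IMust1) $(p,q)\xrightarrow{i}P'$ if $p\xrightarrow{i}_PP'$, no $i$-must from $q$; (IMust2) symmetric; (IMust3) $(p,q)\xrightarrow{i}P'\times Q'$ if both; (May1) $(p,q)\stackrel{\tau}{\dashrightarrow}(p',q)$ if $p\stackrel{\tau}{\Longrightarrow}_Pp'$; (May2) symmetric; (May3) $(p,q)\stackrel{\alpha}{\dashrightarrow}(p',q')$ if $p\stackrel{\alpha}{\Longrightarrow}_Pp'$, $q\stackrel{\alpha}{\Longrightarrow}_Qq'$; (IMay1) $(p,q)\stackrel{i}{\dashrightarrow}p'$ if $p\stackrel{i}{\dashrightarrow}_Pp'$, no $i$-may from $q$; (IMay2) symmetric; (IMay3) $(p,q)\stackrel{i}{\dashrightarrow}(p',q')$ if both. $F\subseteq P\times Q$ least with: (F1) $p\xrightarrow{o}_P$ and not $q\stackrel{o}{\Longrightarrow}_Q$, $o\in O$; (F2) symmetric; (F3) $(p,q)\xrightarrow{a}R'$ with $R'\subseteq F$. $P\wedge Q$ deletes $F$-states, transitions leaving them, may-transitions entering them, and removes them from must-targets; $p\wedge q$ defined iff $(p,q)\notin F$. MIA parallel composition: composability as for IA; product on $P_1\times P_2$ with same $I,O$: (Must1) $(p_1,p_2)\xrightarrow{a}P_1'\times\{p_2\}$ if $p_1\xrightarrow{a}P_1'$, $a\notin A_2$; (Must2) symmetric; (May1) $(p_1,p_2)\stackrel{\alpha}{\dashrightarrow}(p_1',p_2)$ if $p_1\stackrel{\alpha}{\dashrightarrow}p_1'$, $\alpha\notin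 A_2$; (May2) symmetric; (May3) $(p_1,p_2)\stackrel{\tau}{\dashrightarrow}(p_1',p_2')$ if $p_1\stackrel{a}{\dashrightarrow}p_1'$, $p_2\stackrel{a}{\dashrightarrow}p_2'$. Error state: $a\in A_1\cap A_2$ with $a\in O_1$, $p_1\stackrel{a}{\dashrightarrow}$, no $a$-must from $p_2$ (or symmetric). $E$: least set containing error states and states with an $\alpha$-may-transition ($\alpha\in O\cup\{\tau\}$) into $E$. Pruning removes $E$-states, every transition with such a state as source, target or one of its targets, and all may-transitions underlying a removed must-transition; remaining $(p_1,p_2)$ are compatible, written $p_1|p_2$. Embedding: for an IA $P$, $[\![P]\!]$ is the MIA $(P,I,O,\longrightarrow,\dashrightarrow)$ with $p\xrightarrow{i}p'$ (must) iff $p\xrightarrow{i}_Pp'$, $i\in I$, and $p\stackrel{\alpha}{\dashrightarrow}p'$ iff $p\xrightarrow{\alpha}_Pp'$; $[\![p]\!]$ is $p$ as a state of $[\![P]\!]$. *)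

(* Defs.v *)
From Stdlib Require Import Relation_Operators.
From mathcomp Require Import all_boot boolp classical_sets.

Set Implicit Arguments.
Unset Strict Implicit.
Unset Printing Implicit Defensive.

Local Open Scope classical_set_scope.

(** * Labels *)

(* [Act] is the universe of visible actions.  A label is [Some a] for a visible
   action [a], or [None] for the internal action, so no alphabet contains tau. *)
Notation tau := None (only parsing).

Definition visible_in {Act : Type} (A : set Act) (l : option Act) : Prop :=
  if l is Some a then A a else False.

Definition in_tau {Act : Type} (A : set Act) (l : option Act) : Prop :=
  if l is Some a then A a else True.

(** * Interface automata and modal interface automata *)

(* The alphabets are indices of the types [IA] and [MIA]; two automata with
   common alphabets are two inhabitants of the same type. *)

Record IA (Act : Type) (I O : set Act) : Type := MkIA {
  ia_state :> Type;
  ia_trans : ia_state -> option Act -> ia_state -> Prop;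
  ia_disjoint : I `&` O = set0;
  ia_label : forall p l p', ia_trans p l p' -> in_tau (I `|` O) l;
  ia_det : forall p a p' p'', I a ->
    ia_trans p (Some a) p' -> ia_trans p (Some a) p'' -> p' = p'' }.

Record MIA (Act : Type) (I O : set Act) : Type := MkMIA {
  mia_state :> Type;
  must : mia_state -> Act -> set mia_state -> Prop;
  may : mia_state -> option Act -> mia_state -> Prop;
  mia_disjoint : I `&` O = set0;
  must_label : forall p a P', must p a P' -> (I `|` O) a;
  may_label : forall p l p', may p l p' -> in_tau (I `|` O) l;
  must_nonempty : forall p a P', must p a P' -> P' !=set0;
  must_may : forall p a P' p', must p a P' -> P' p' -> may p (Some a) p';
  must_input_det : forall p i P' P'', I i ->
    must p i P' -> must p i P'' -> P' = P'';
  may_input_must : forall p i p', I i ->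
    may p (Some i) p' -> exists2 P', must p i P' & P' p' }.

Definition ia_enabled Act (I O : set Act) (P : IA I O) (p : P) (a : Act) :=
  exists p', ia_trans p (Some a) p'.

Definition must_enabled Act (I O : set Act) (P : MIA I O) (p : P) (a : Act) :=
  exists P', must p a P'.

Definition may_enabled Act (I O : set Act) (P : MIA I O) (p : P) (a : Act) :=
  exists p', may p (Some a) p'.

Definition weak_eps Act (I O : set Act) (P : MIA I O) (p p' : P) : Prop :=
  clos_refl_trans P (fun x y => may x tau y) p p'.

Definition weak_may Act (I O : set Act) (P : MIA I O) (p : P) (l : option Act)
    (p' : P) : Prop :=
  exists2 p'', weak_eps p p'' & may p'' l p'.

Definition weak_enabled Act (I O : set Act) (P : MIA I O) (p : P) (a : Act) :=
  exists p', weak_may p (Some a) p'.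

Definition weak_may_hat Act (I O : set Act) (P : MIA I O) (p : P)
    (l : option Act) (p' : P) : Prop :=
  if l is Some a then weak_may p (Some a) p' else weak_eps p p'.

Definition mia_refinement Act (I O : set Act) (P Q : MIA I O)
    (R : P -> Q -> Prop) : Prop :=
  forall p q, R p q ->
    (forall a Q', must q a Q' ->
       exists2 P', must p a P' & forall p', P' p' -> exists2 q', Q' q' & R p' q')
    /\
    (forall l p', in_tau O l -> may p l p' ->
       exists2 q', weak_may_hat q l q' & R p' q').

Definition mia_le Act (I O : set Act) (P Q : MIA I O) (p : P) (q : Q) : Prop :=
  exists2 R : P -> Q -> Prop, mia_refinement R & R p q.

Definition mia_eq Act (I O : set Act) (P Q : MIA I O) (p : P) (q : Q) : Prop :=
  mia_le p q /\ mia_le q p.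

(** * Conjunction *)

(* The tagged union makes the state sets of the two components disjoint. *)
Inductive conj_state (S T : Type) : Type :=
| Cpair of S & T
| Cleft of S
| Cright of T.
Arguments Cpair {S T}.
Arguments Cleft {S T}.
Arguments Cright {S T}.

Definition Cprod (S T : Type) (A : set S) (B : set T) : set (conj_state S T) :=
  [set s | exists p q, [/\ A p, B q & s = Cpair p q]].

Inductive ia_conj_trans Act (I O : set Act) (P Q : IA I O) :
    conj_state P Q -> option Act -> conj_state P Q -> Prop :=
| IAC_left p l p' : ia_trans p l p' -> ia_conj_trans (Cleft p) l (Cleft p')
| IAC_right q l q' : ia_trans q l q' -> ia_conj_trans (Cright q) l (Cright q')
| IAC_I1 p q a p' : I a -> ia_trans p (Some a) p' -> ~ ia_enabled q a ->
    ia_conj_trans (Cpair p q) (Some a) (Cleft p')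
| IAC_I2 p q a q' : I a -> ~ ia_enabled p a -> ia_trans q (Some a) q' ->
    ia_conj_trans (Cpair p q) (Some a) (Cright q')
| IAC_I3O p q a p' q' : (I `|` O) a ->
    ia_trans p (Some a) p' -> ia_trans q (Some a) q' ->
    ia_conj_trans (Cpair p q) (Some a) (Cpair p' q')
| IAC_T1 p q p' : ia_trans p tau p' ->
    ia_conj_trans (Cpair p q) tau (Cpair p' q)
| IAC_T2 p q q' : ia_trans q tau q' ->
    ia_conj_trans (Cpair p q) tau (Cpair p q').

Lemma ia_conj_label Act (I O : set Act) (P Q : IA I O) s l s' :
  @ia_conj_trans Act I O P Q s l s' -> in_tau (I `|` O) l.
Proof. by case=> *; solve [done | eapply ia_label; eassumption | by left]. Qed.

Lemma ia_conj_det Act (I O : set Act) (P Q : IA I O) s a s' s'' : I a ->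
  @ia_conj_trans Act I O P Q s (Some a) s' ->
  ia_conj_trans s (Some a) s'' -> s' = s''.
Proof.
move=> Ia H1 H2; inversion H1; subst; inversion H2; subst => //;
  try (by exfalso; match goal with H : ~ ia_enabled _ _ |- _ =>
        apply: H; eexists; eassumption end);
  repeat match goal with
  | H : ia_trans ?p (Some a) ?x, H' : ia_trans ?p (Some a) ?y |- _ =>
      move: (ia_det Ia H H') => ?; subst; clear H
  end; done.
Qed.

Definition ia_conj Act (I O : set Act) (P Q : IA I O) : IA I O :=
  MkIA (ia_disjoint P) (@ia_conj_label Act I O P Q) (@ia_conj_det Act I O P Q).

Definition ia_conj_st Act (I O : set Act) (P Q : IA I O) (p : P) (q : Q) :
  ia_conj P Q := Cpair p q.

Inductive cmust Act (I O : set Act) (P Q : MIA I O) :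
    conj_state P Q -> Act -> set (conj_state P Q) -> Prop :=
| CM_left p a P' : must p a P' -> cmust (Cleft p) a (Cleft @` P')
| CM_right q a Q' : must q a Q' -> cmust (Cright q) a (Cright @` Q')
| OMust1 p q o P' : O o -> must p o P' -> weak_enabled q o ->
    cmust (Cpair p q) o (Cprod P' [set q' | weak_may q (Some o) q'])
| OMust2 p q o Q' : O o -> weak_enabled p o -> must q o Q' ->
    cmust (Cpair p q) o (Cprod [set p' | weak_may p (Some o) p'] Q')
| IMust1 p q i P' : I i -> must p i P' -> ~ must_enabled q i ->
    cmust (Cpair p q) i (Cleft @` P')
| IMust2 p q i Q' : I i -> ~ must_enabled p i -> must q i Q' ->
    cmust (Cpair p q) i (Cright @` Q')
| IMust3 p q i P' Q' : I i -> must p i P' -> must q i Q' ->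
    cmust (Cpair p q) i (Cprod P' Q').

Inductive cmay Act (I O : set Act) (P Q : MIA I O) :
    conj_state P Q -> option Act -> conj_state P Q -> Prop :=
| Cm_left p l p' : may p l p' -> cmay (Cleft p) l (Cleft p')
| Cm_right q l q' : may q l q' -> cmay (Cright q) l (Cright q')
| May1 p q p' : weak_may p tau p' -> cmay (Cpair p q) tau (Cpair p' q)
| May2 p q q' : weak_may q tau q' -> cmay (Cpair p q) tau (Cpair p q')
| May3 p q l p' q' : in_tau O l -> weak_may p l p' -> weak_may q l q' ->
    cmay (Cpair p q) l (Cpair p' q')
| IMay1 p q i p' : I i -> may p (Some i) p' -> ~ may_enabled q i ->
    cmay (Cpair p q) (Some i) (Cleft p')
| IMay2 p q i q' : I i -> ~ may_enabled p i -> may q (Some i) q' ->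
    cmay (Cpair p q) (Some i) (Cright q')
| IMay3 p q i p' q' : I i -> may p (Some i) p' -> may q (Some i) q' ->
    cmay (Cpair p q) (Some i) (Cpair p' q').

(* The set F of inconsistent states; it only contains pairs. *)
Inductive inconsistent Act (I O : set Act) (P Q : MIA I O) :
    set (conj_state P Q) :=
| F1 p q o : O o -> must_enabled p o -> ~ weak_enabled q o ->
    inconsistent (Cpair p q)
| F2 p q o : O o -> must_enabled q o -> ~ weak_enabled p o ->
    inconsistent (Cpair p q)
| F3 p q a R' : cmust (Cpair p q) a R' -> (forall r, R' r -> inconsistent r) ->
    inconsistent (Cpair p q).

Definition conj_sub Act (I O : set Act) (P Q : MIA I O) : Type :=
  {s : conj_state P Q | ~ inconsistent s}.

(* Inconsistent states are dropped from the target set of a must-transition;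
   the transition itself survives as long as its source does. *)
Definition conj_must Act (I O : set Act) (P Q : MIA I O)
    (s : conj_sub P Q) (a : Act) (T : set (conj_sub P Q)) : Prop :=
  exists2 R', cmust (sval s) a R' & T = [set t | R' (sval t)].

Definition conj_may Act (I O : set Act) (P Q : MIA I O)
    (s : conj_sub P Q) (l : option Act) (t : conj_sub P Q) : Prop :=
  cmay (sval s) l (sval t).

Lemma IO_absurd Act (I O : set Act) (a : Act) :
  I `&` O = set0 -> I a -> O a -> False.
Proof. by move=> E Ia Oa; have : (I `&` O) a by []; rewrite E. Qed.

Lemma weak_may_label Act (I O : set Act) (P : MIA I O) (p p' : P) l :
  weak_may p l p' -> in_tau (I `|` O) l.
Proof. by case=> p'' _ /may_label. Qed.

Lemma may_weak Act (I O : set Act) (P : MIA I O) (p p' : P) l :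
  may p l p' -> weak_may p l p'.
Proof. by exists p => //; exact: rt_refl. Qed.

Lemma may_must_enabled Act (I O : set Act) (P : MIA I O) (p : P) i :
  I i -> may_enabled p i -> must_enabled p i.
Proof. by move=> Ii [p' /(may_input_must Ii)[P' h _]]; exists P'. Qed.

Lemma must_may_enabled Act (I O : set Act) (P : MIA I O) (p : P) i :
  must_enabled p i -> may_enabled p i.
Proof.
by move=> [P' h]; have [p' hp'] := must_nonempty h; exists p'; exact: must_may h _.
Qed.

Lemma cmust_label Act (I O : set Act) (P Q : MIA I O) s a R' :
  @cmust Act I O P Q s a R' -> (I `|` O) a.
Proof. by case=> *; solve [eapply must_label; eassumption | by left | by right]. Qed.

Lemma cmay_label Act (I O : set Act) (P Q : MIA I O) s l s' :
  @cmay Act I O P Q s l s' -> in_tau (I `|` O) l.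
Proof.
by case=> *; solve [eapply may_label; eassumption | eapply weak_may_label; eassumption | done | by left].
Qed.

Lemma cmust_nonempty Act (I O : set Act) (P Q : MIA I O) s a R' :
  @cmust Act I O P Q s a R' -> R' !=set0.
Proof.
case=> {s a R'}.
- by move=> p a P' h; have [x hx] := must_nonempty h; exists (Cleft x), x.
- by move=> p a P' h; have [x hx] := must_nonempty h; exists (Cright x), x.
- move=> p q o P' _ h [y hy]; have [x hx] := must_nonempty h.
  by exists (Cpair x y), x, y.
- move=> p q o P' _ [y hy] h; have [x hx] := must_nonempty h.
  by exists (Cpair y x), y, x.
- by move=> p q i P' _ h _; have [x hx] := must_nonempty h; exists (Cleft x), x.
- by move=> p q i P' _ _ h; have [x hx] := must_nonempty h; exists (Cright x), x.
- move=> p q i P' Q' _ h k; have [x hx] := must_nonempty h.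
  by have [y hy] := must_nonempty k; exists (Cpair x y), x, y.
Qed.

Lemma cmust_cmay Act (I O : set Act) (P Q : MIA I O) s a R' s' :
  @cmust Act I O P Q s a R' -> R' s' -> cmay s (Some a) s'.
Proof.
case=> {s a R'}.
- by move=> p a P' h [x hx <-]; constructor; exact: must_may h _.
- by move=> p a P' h [x hx <-]; constructor; exact: must_may h _.
- move=> p q o P' Oo h _ [x [y [hx hy ->]]]; apply: May3 => //.
  by apply: may_weak; exact: must_may h _.
- move=> p q o P' Oo _ h [x [y [hx hy ->]]]; apply: May3 => //.
  by apply: may_weak; exact: must_may h _.
- move=> p q i P' Ii h nq [x hx <-]; apply: IMay1 => //.
    exact: must_may h _.
  by move=> /(may_must_enabled Ii).
- move=> p q i P' Ii nq h [x hx <-]; apply: IMay2 => //.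
    by move=> /(may_must_enabled Ii).
  exact: must_may h _.
- move=> p q i P' Q' Ii h h' [x [y [hx hy ->]]]; apply: IMay3 => //.
    exact: must_may h _.
  exact: must_may h' _.
Qed.

Lemma cmust_input_det Act (I O : set Act) (P Q : MIA I O) s i R' R'' : I i ->
  @cmust Act I O P Q s i R' -> cmust s i R'' -> R' = R''.
Proof.
move=> Ii H1 H2; have nO : ~ O i by exact: (IO_absurd (mia_disjoint P) Ii).
inversion H1; subst; inversion H2; subst => //;
  try (by exfalso; match goal with H : ~ must_enabled _ _ |- _ =>
        apply: H; eexists; eassumption end);
  repeat match goal with
  | H : must ?p i ?x, H' : must ?p i ?y |- _ =>
      move: (must_input_det Ii H H') => ?; subst; clear H
  end; done.
Qed.

Lemma cmay_input_must Act (I O : set Act) (P Q : MIA I O) s i s' : I i ->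
  @cmay Act I O P Q s (Some i) s' -> exists2 R', cmust s i R' & R' s'.
Proof.
move=> Ii; have nO : ~ O i by exact: (IO_absurd (mia_disjoint P) Ii).
move El: (Some i) => l H; case: H El => {s l s'} //.
- move=> p l p' h El; rewrite -El in h.
  case: (may_input_must Ii h) => P' h1 h2.
  by exists (Cleft @` P'); [constructor | exists p'].
- move=> q l q' h El; rewrite -El in h.
  case: (may_input_must Ii h) => P' h1 h2.
  by exists (Cright @` P'); [constructor | exists q'].
- by move=> p q l p' q' Ol _ _ El; rewrite -El in Ol.
- move=> p q j p' _ h n [Ej]; rewrite -Ej in h n; case: (may_input_must Ii h) => P' h1 h2.
  exists (Cleft @` P'); last by exists p'.
  by apply: IMust1 => // k; apply: n; exact: must_may_enabled.
- move=> p q j q' _ n h [Ej]; rewrite -Ej in n h; case: (may_input_must Ii h) => P' h1 h2.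
  exists (Cright @` P'); last by exists q'.
  by apply: IMust2 => // k; apply: n; exact: must_may_enabled.
- move=> p q j p' q' _ h h' [Ej]; rewrite -Ej in h h'.
  case: (may_input_must Ii h) => P' h1 h2.
  case: (may_input_must Ii h') => Q' h3 h4.
  by exists (Cprod P' Q'); [exact: IMust3 | exists p', q'].
Qed.

Lemma conj_must_label Act (I O : set Act) (P Q : MIA I O) s a T :
  @conj_must Act I O P Q s a T -> (I `|` O) a.
Proof. by case=> R' h _; exact: cmust_label h. Qed.

Lemma conj_may_label Act (I O : set Act) (P Q : MIA I O) s l t :
  @conj_may Act I O P Q s l t -> in_tau (I `|` O) l.
Proof. exact: cmay_label. Qed.

Lemma conj_must_nonempty Act (I O : set Act) (P Q : MIA I O) s a T :
  @conj_must Act I O P Q s a T -> T !=set0.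
Proof.
case: s => s hs [R' /= h ->]; apply: contrapT => hT.
have RF : forall r, R' r -> inconsistent r.
  by move=> r hr; apply: contrapT => nr; apply: hT; exists (exist _ r nr).
case: (cmust_nonempty h) => r hr.
case: s hs h => [p q|p|q] hs h.
- by apply: hs; exact: F3 h RF.
- have := RF r hr; inversion h; subst; case: hr => x _ <- H; by inversion H.
- have := RF r hr; inversion h; subst; case: hr => x _ <- H; by inversion H.
Qed.

Lemma conj_must_may Act (I O : set Act) (P Q : MIA I O) s a T t :
  @conj_must Act I O P Q s a T -> T t -> conj_may s (Some a) t.
Proof. by case=> R' h -> /= ht; exact: cmust_cmay h ht. Qed.

Lemma conj_must_input_det Act (I O : set Act) (P Q : MIA I O) s i T T' : I i ->
  @conj_must Act I O P Q s i T -> conj_must s i T' -> T = T'.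
Proof. by move=> Ii [R h ->] [R' h' ->]; rewrite (cmust_input_det Ii h h'). Qed.

Lemma conj_may_input_must Act (I O : set Act) (P Q : MIA I O) s i t : I i ->
  @conj_may Act I O P Q s (Some i) t -> exists2 T, conj_must s i T & T t.
Proof.
move=> Ii /(cmay_input_must Ii)[R' h ht].
by exists [set t | R' (sval t)] => //; exists R'.
Qed.

Definition mia_conj Act (I O : set Act) (P Q : MIA I O) : MIA I O :=
  MkMIA (mia_disjoint P)
    (@conj_must_label Act I O P Q) (@conj_may_label Act I O P Q)
    (@conj_must_nonempty Act I O P Q) (@conj_must_may Act I O P Q)
    (@conj_must_input_det Act I O P Q) (@conj_may_input_must Act I O P Q).

Definition mia_conj_defined Act (I O : set Act) (P Q : MIA I O)
    (p : P) (q : Q) : Prop :=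
  ~ inconsistent (Cpair p q).

Definition mia_conj_st Act (I O : set Act) (P Q : MIA I O) (p : P) (q : Q)
    (h : mia_conj_defined p q) : mia_conj P Q :=
  exist _ (Cpair p q) h.

(** * Parallel composition *)

Definition composable Act (I1 O1 I2 O2 : set Act) : Prop :=
  (I1 `|` O1) `&` (I2 `|` O2) = (I1 `&` O2) `|` (O1 `&` I2).

Definition par_in Act (I1 O1 I2 O2 : set Act) : set Act :=
  (I1 `|` I2) `\` (O1 `|` O2).

Definition par_out Act (I1 O1 I2 O2 : set Act) : set Act :=
  (O1 `|` O2) `\` (I1 `|` I2).

Inductive ia_par_trans Act (I1 O1 I2 O2 : set Act)
    (P1 : IA I1 O1) (P2 : IA I2 O2) :
    P1 * P2 -> option Act -> P1 * P2 -> Prop :=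
| IAP_Par1 p1 p2 l p1' : ia_trans p1 l p1' -> ~ visible_in (I2 `|` O2) l ->
    ia_par_trans (p1, p2) l (p1', p2)
| IAP_Par2 p1 p2 l p2' : ia_trans p2 l p2' -> ~ visible_in (I1 `|` O1) l ->
    ia_par_trans (p1, p2) l (p1, p2')
| IAP_Par3 p1 p2 a p1' p2' :
    ia_trans p1 (Some a) p1' -> ia_trans p2 (Some a) p2' ->
    ia_par_trans (p1, p2) tau (p1', p2').

Definition ia_error Act (I1 O1 I2 O2 : set Act)
    (P1 : IA I1 O1) (P2 : IA I2 O2) : set (P1 * P2) :=
  [set s | exists2 a, ((I1 `|` O1) `&` (I2 `|` O2)) a &
     [/\ O1 a, ia_enabled s.1 a & ~ ia_enabled s.2 a] \/
     [/\ O2 a, ia_enabled s.2 a & ~ ia_enabled s.1 a]].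

Inductive ia_illegal Act (I1 O1 I2 O2 : set Act)
    (P1 : IA I1 O1) (P2 : IA I2 O2) : set (P1 * P2) :=
| IAE_error s : ia_error s -> ia_illegal s
| IAE_step s l s' : in_tau (par_out I1 O1 I2 O2) l ->
    ia_par_trans s l s' -> ia_illegal s' -> ia_illegal s.

Definition ia_compatible Act (I1 O1 I2 O2 : set Act)
    (P1 : IA I1 O1) (P2 : IA I2 O2) (p1 : P1) (p2 : P2) : Prop :=
  ~ ia_illegal (p1, p2).

Definition ia_par_sub Act (I1 O1 I2 O2 : set Act)
    (P1 : IA I1 O1) (P2 : IA I2 O2) : Type :=
  {s : P1 * P2 | ~ ia_illegal s}.

Definition ia_par_sub_trans Act (I1 O1 I2 O2 : set Act)
    (P1 : IA I1 O1) (P2 : IA I2 O2)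
    (s : ia_par_sub P1 P2) (l : option Act) (t : ia_par_sub P1 P2) : Prop :=
  ia_par_trans (sval s) l (sval t).

Lemma par_disjoint Act (I1 O1 I2 O2 : set Act) :
  par_in I1 O1 I2 O2 `&` par_out I1 O1 I2 O2 = set0.
Proof. by apply/seteqP; split=> a // [[h _] [_ /(_ h)]]. Qed.

Lemma par_label1 Act (I1 O1 I2 O2 : set Act) (a : Act) :
  I1 `&` O1 = set0 -> (I1 `|` O1) a -> ~ (I2 `|` O2) a ->
  (par_in I1 O1 I2 O2 `|` par_out I1 O1 I2 O2) a.
Proof.
move=> d [h|h] n; [left|right]; split; try (by left);
  by case=> k; [apply: (IO_absurd d (a := a))|apply: n; by [left|right]].
Qed.

Lemma par_label2 Act (I1 O1 I2 O2 : set Act) (a : Act) :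
  I2 `&` O2 = set0 -> (I2 `|` O2) a -> ~ (I1 `|` O1) a ->
  (par_in I1 O1 I2 O2 `|` par_out I1 O1 I2 O2) a.
Proof.
move=> d [h|h] n; [left|right]; split; try (by right);
  by case=> k; [apply: n; by [left|right]|apply: (IO_absurd d (a := a))].
Qed.

Lemma par_in1 Act (I1 O1 I2 O2 : set Act) (a : Act) :
  par_in I1 O1 I2 O2 a -> ~ (I2 `|` O2) a -> I1 a.
Proof. by case=> -[//|h] _ n; case: n; left. Qed.

Lemma par_in2 Act (I1 O1 I2 O2 : set Act) (a : Act) :
  par_in I1 O1 I2 O2 a -> ~ (I1 `|` O1) a -> I2 a.
Proof. by case=> -[h|//] _ n; case: n; left. Qed.

Lemma ia_par_label Act (I1 O1 I2 O2 : set Act)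
    (P1 : IA I1 O1) (P2 : IA I2 O2) (s : ia_par_sub P1 P2) l t :
  ia_par_sub_trans s l t ->
  in_tau (par_in I1 O1 I2 O2 `|` par_out I1 O1 I2 O2) l.
Proof.
rewrite /ia_par_sub_trans; case=> //= p1 p2 [a|] //= x /ia_label /= h n.
- exact: (par_label1 (ia_disjoint P1)).
- exact: (par_label2 (ia_disjoint P2)).
Qed.

Lemma sub_inj (T : Type) (A : T -> Prop) (x y : {t | A t}) :
  sval x = sval y -> x = y.
Proof. by case: x y => [x hx] [y hy] /= E; subst; congr exist; exact: Prop_irrelevance. Qed.

Lemma ia_par_det Act (I1 O1 I2 O2 : set Act)
    (P1 : IA I1 O1) (P2 : IA I2 O2) (s : ia_par_sub P1 P2) a t t' :
  par_in I1 O1 I2 O2 a ->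
  ia_par_sub_trans s (Some a) t -> ia_par_sub_trans s (Some a) t' -> t = t'.
Proof.
move=> Ia H1 H2; apply: sub_inj; move: H1 H2; rewrite /ia_par_sub_trans.
move: (sval s) (sval t) (sval t') => {s t t'} s t t' H1 H2.
inversion H1; subst; inversion H2; subst; solve
  [ exfalso; match goal with n : ~ visible_in _ _, k : ia_trans _ _ _ |- _ =>
      by apply: n; exact: ia_label k end
  | match goal with n : ~ visible_in _ _,
        h : ia_trans _ _ _, k : ia_trans _ _ _ |- _ =>
      first [ by rewrite (ia_det (par_in1 Ia n) h k)
            | by rewrite (ia_det (par_in2 Ia n) h k) ] end ].
Qed.

Definition ia_par Act (I1 O1 I2 O2 : set Act)
    (P1 : IA I1 O1) (P2 : IA I2 O2) :
    IA (par_in I1 O1 I2 O2) (par_out I1 O1 I2 O2) :=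
  MkIA (par_disjoint I1 O1 I2 O2)
    (@ia_par_label _ _ _ _ _ P1 P2) (@ia_par_det _ _ _ _ _ P1 P2).

Definition ia_par_st Act (I1 O1 I2 O2 : set Act)
    (P1 : IA I1 O1) (P2 : IA I2 O2) (p1 : P1) (p2 : P2)
    (h : ia_compatible p1 p2) : ia_par P1 P2 :=
  exist _ (p1, p2) h.

Inductive pmust Act (I1 O1 I2 O2 : set Act)
    (P1 : MIA I1 O1) (P2 : MIA I2 O2) :
    P1 * P2 -> Act -> set (P1 * P2) -> Prop :=
| PMust1 p1 p2 a P1' : must p1 a P1' -> ~ (I2 `|` O2) a ->
    pmust (p1, p2) a (P1' `*` [set p2])
| PMust2 p1 p2 a P2' : must p2 a P2' -> ~ (I1 `|` O1) a ->
    pmust (p1, p2) a ([set p1] `*` P2').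

Inductive pmay Act (I1 O1 I2 O2 : set Act)
    (P1 : MIA I1 O1) (P2 : MIA I2 O2) :
    P1 * P2 -> option Act -> P1 * P2 -> Prop :=
| PMay1 p1 p2 l p1' : may p1 l p1' -> ~ visible_in (I2 `|` O2) l ->
    pmay (p1, p2) l (p1', p2)
| PMay2 p1 p2 l p2' : may p2 l p2' -> ~ visible_in (I1 `|` O1) l ->
    pmay (p1, p2) l (p1, p2')
| PMay3 p1 p2 a p1' p2' : may p1 (Some a) p1' -> may p2 (Some a) p2' ->
    pmay (p1, p2) tau (p1', p2').

Definition mia_error Act (I1 O1 I2 O2 : set Act)
    (P1 : MIA I1 O1) (P2 : MIA I2 O2) : set (P1 * P2) :=
  [set s | exists2 a, ((I1 `|` O1) `&` (I2 `|` O2)) a &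
     [/\ O1 a, may_enabled s.1 a & ~ must_enabled s.2 a] \/
     [/\ O2 a, may_enabled s.2 a & ~ must_enabled s.1 a]].

Inductive mia_illegal Act (I1 O1 I2 O2 : set Act)
    (P1 : MIA I1 O1) (P2 : MIA I2 O2) : set (P1 * P2) :=
| ME_error s : mia_error s -> mia_illegal s
| ME_step s l s' : in_tau (par_out I1 O1 I2 O2) l ->
    pmay s l s' -> mia_illegal s' -> mia_illegal s.

Definition mia_compatible Act (I1 O1 I2 O2 : set Act)
    (P1 : MIA I1 O1) (P2 : MIA I2 O2) (p1 : P1) (p2 : P2) : Prop :=
  ~ mia_illegal (p1, p2).

Definition par_sub Act (I1 O1 I2 O2 : set Act)
    (P1 : MIA I1 O1) (P2 : MIA I2 O2) : Type :=
  {s : P1 * P2 | ~ mia_illegal s}.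

Definition pmust_removed Act (I1 O1 I2 O2 : set Act)
    (P1 : MIA I1 O1) (P2 : MIA I2 O2)
    (s : P1 * P2) (a : Act) (R' : set (P1 * P2)) : Prop :=
  pmust s a R' /\ (mia_illegal s \/ exists2 r, R' r & mia_illegal r).

(* A surviving must-transition has no illegal target, so passing to the subtype
   loses no element of its target set. *)
Definition par_must Act (I1 O1 I2 O2 : set Act)
    (P1 : MIA I1 O1) (P2 : MIA I2 O2)
    (s : par_sub P1 P2) (a : Act) (T : set (par_sub P1 P2)) : Prop :=
  exists R', [/\ pmust (sval s) a R', ~ pmust_removed (sval s) a R'
               & T = [set t | R' (sval t)]].

Definition par_may Act (I1 O1 I2 O2 : set Act)
    (P1 : MIA I1 O1) (P2 : MIA I2 O2)
    (s : par_sub P1 P2) (l : option Act) (t : par_sub P1 P2) : Prop :=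
  pmay (sval s) l (sval t) /\
  ~ (exists a R', [/\ l = Some a, pmust_removed (sval s) a R' & R' (sval t)]).

Lemma pmust_label Act (I1 O1 I2 O2 : set Act)
    (P1 : MIA I1 O1) (P2 : MIA I2 O2) (s : P1 * P2) a R' :
  pmust s a R' -> (par_in I1 O1 I2 O2 `|` par_out I1 O1 I2 O2) a.
Proof.
case=> p1 p2 {}a X k n; have h := must_label k.
- exact: (par_label1 (mia_disjoint P1)).
- exact: (par_label2 (mia_disjoint P2)).
Qed.

Lemma pmay_label Act (I1 O1 I2 O2 : set Act)
    (P1 : MIA I1 O1) (P2 : MIA I2 O2) (s : P1 * P2) l t :
  pmay s l t -> in_tau (par_in I1 O1 I2 O2 `|` par_out I1 O1 I2 O2) l.
Proof.
case=> //= p1 p2 [a|] //= x /may_label /= h n.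
- exact: (par_label1 (mia_disjoint P1)).
- exact: (par_label2 (mia_disjoint P2)).
Qed.

Lemma pmust_nonempty Act (I1 O1 I2 O2 : set Act)
    (P1 : MIA I1 O1) (P2 : MIA I2 O2) (s : P1 * P2) a R' :
  pmust s a R' -> R' !=set0.
Proof.
by case=> p1 p2 {}a X h _; have [x hx] := must_nonempty h;
  [exists (x, p2)|exists (p1, x)].
Qed.

Lemma pmust_pmay Act (I1 O1 I2 O2 : set Act)
    (P1 : MIA I1 O1) (P2 : MIA I2 O2) (s : P1 * P2) a R' t :
  pmust s a R' -> R' t -> pmay s (Some a) t.
Proof.
case=> p1 p2 {}a X h n; case: t => x y [/= hx hy].
- by rewrite hy; apply: PMay1 => //; exact: must_may h hx.
- by rewrite hx; apply: PMay2 => //; exact: must_may h hy.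
Qed.

Lemma pmust_input_det Act (I1 O1 I2 O2 : set Act)
    (P1 : MIA I1 O1) (P2 : MIA I2 O2) (s : P1 * P2) i R' R'' :
  par_in I1 O1 I2 O2 i -> pmust s i R' -> pmust s i R'' -> R' = R''.
Proof.
move=> Ii H1 H2; inversion H1; subst; inversion H2; subst; solve
  [ exfalso; match goal with n : ~ (_ `|` _) _, k : must _ _ _ |- _ =>
      by apply: n; exact: must_label k end
  | match goal with n : ~ (_ `|` _) _,
        h : must _ _ _, k : must _ _ _ |- _ =>
      first [ by rewrite (must_input_det (par_in1 Ii n) h k)
            | by rewrite (must_input_det (par_in2 Ii n) h k) ] end ].
Qed.

Lemma pmay_input_must Act (I1 O1 I2 O2 : set Act)
    (P1 : MIA I1 O1) (P2 : MIA I2 O2) (s : P1 * P2) i t :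
  par_in I1 O1 I2 O2 i -> pmay s (Some i) t -> exists2 R', pmust s i R' & R' t.
Proof.
move=> Ii; move El: (Some i) => l H; case: H El => {s l t} //.
- move=> p1 p2 l p1' h n El; rewrite -El in h n.
  case: (may_input_must (par_in1 Ii n) h) => X k hx.
  by exists (X `*` [set p2]); [exact: PMust1|].
- move=> p1 p2 l p2' h n El; rewrite -El in h n.
  case: (may_input_must (par_in2 Ii n) h) => X k hx.
  by exists ([set p1] `*` X); [exact: PMust2|].
Qed.

Lemma par_must_label Act (I1 O1 I2 O2 : set Act)
    (P1 : MIA I1 O1) (P2 : MIA I2 O2) (s : par_sub P1 P2) a T :
  par_must s a T -> (par_in I1 O1 I2 O2 `|` par_out I1 O1 I2 O2) a.
Proof. by case=> R' [h _ _]; exact: pmust_label h. Qed.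

Lemma par_may_label Act (I1 O1 I2 O2 : set Act)
    (P1 : MIA I1 O1) (P2 : MIA I2 O2) (s : par_sub P1 P2) l t :
  par_may s l t -> in_tau (par_in I1 O1 I2 O2 `|` par_out I1 O1 I2 O2) l.
Proof. by case=> /pmay_label. Qed.

Lemma par_must_nonempty Act (I1 O1 I2 O2 : set Act)
    (P1 : MIA I1 O1) (P2 : MIA I2 O2) (s : par_sub P1 P2) a T :
  par_must s a T -> T !=set0.
Proof.
case=> R' [h n ->]; have [r hr] := pmust_nonempty h.
have nr : ~ mia_illegal r by move=> Er; apply: n; split=> //; right; exists r.
by exists (exist _ r nr).
Qed.

Lemma par_must_may Act (I1 O1 I2 O2 : set Act)
    (P1 : MIA I1 O1) (P2 : MIA I2 O2) (s : par_sub P1 P2) a T t :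
  par_must s a T -> T t -> par_may s (Some a) t.
Proof.
case=> R' [h n ->] /= ht; split; first exact: pmust_pmay h ht.
case=> b [R'' [[<-] rem ht']].
case: (rem) => h' bad; case: (pmust_label h) => [Ia|Oa].
  by apply: n; rewrite (pmust_input_det Ia h h').
apply: (svalP s); case: bad => // -[r hr Er].
by apply: (@ME_step _ _ _ _ _ _ _ _ (Some a) r) => //; exact: pmust_pmay h' hr.
Qed.

Lemma par_must_input_det Act (I1 O1 I2 O2 : set Act)
    (P1 : MIA I1 O1) (P2 : MIA I2 O2) (s : par_sub P1 P2) i T T' :
  par_in I1 O1 I2 O2 i -> par_must s i T -> par_must s i T' -> T = T'.
Proof.
by move=> Ii [R [h _ ->]] [R' [h' _ ->]]; rewrite (pmust_input_det Ii h h').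
Qed.

Lemma par_may_input_must Act (I1 O1 I2 O2 : set Act)
    (P1 : MIA I1 O1) (P2 : MIA I2 O2) (s : par_sub P1 P2) i t :
  par_in I1 O1 I2 O2 i -> par_may s (Some i) t ->
  exists2 T, par_must s i T & T t.
Proof.
move=> Ii [/(pmay_input_must Ii)[R' h ht] n].
exists [set t | R' (sval t)] => //; exists R'; split=> // rem.
by apply: n; exists i, R'.
Qed.

Definition mia_par Act (I1 O1 I2 O2 : set Act)
    (P1 : MIA I1 O1) (P2 : MIA I2 O2) :
    MIA (par_in I1 O1 I2 O2) (par_out I1 O1 I2 O2) :=
  MkMIA (par_disjoint I1 O1 I2 O2)
    (@par_must_label _ _ _ _ _ P1 P2) (@par_may_label _ _ _ _ _ P1 P2)
    (@par_must_nonempty _ _ _ _ _ P1 P2) (@par_must_may _ _ _ _ _ P1 P2)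
    (@par_must_input_det _ _ _ _ _ P1 P2)
    (@par_may_input_must _ _ _ _ _ P1 P2).

Definition mia_par_st Act (I1 O1 I2 O2 : set Act)
    (P1 : MIA I1 O1) (P2 : MIA I2 O2) (p1 : P1) (p2 : P2)
    (h : mia_compatible p1 p2) : mia_par P1 P2 :=
  exist _ (p1, p2) h.

(** * Embedding of interface automata *)

Definition emb_must Act (I O : set Act) (P : IA I O)
    (p : P) (a : Act) (T : set P) : Prop :=
  exists p', [/\ I a, ia_trans p (Some a) p' & T = [set p']].

Lemma emb_must_label Act (I O : set Act) (P : IA I O) (p : P) a T :
  emb_must p a T -> (I `|` O) a.
Proof. by case=> p' [Ia _ _]; left. Qed.

Lemma emb_must_nonempty Act (I O : set Act) (P : IA I O) (p : P) a T :
  emb_must p a T -> T !=set0.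
Proof. by case=> p' [_ _ ->]; exists p'. Qed.

Lemma emb_must_may Act (I O : set Act) (P : IA I O) (p : P) a T p' :
  emb_must p a T -> T p' -> ia_trans p (Some a) p'.
Proof. by case=> x [_ h ->] ->. Qed.

Lemma emb_must_input_det Act (I O : set Act) (P : IA I O) (p : P) i T T' :
  I i -> emb_must p i T -> emb_must p i T' -> T = T'.
Proof. by move=> Ii [x [_ h ->]] [y [_ k ->]]; rewrite (ia_det Ii h k). Qed.

Lemma emb_may_input_must Act (I O : set Act) (P : IA I O) (p : P) i p' :
  I i -> ia_trans p (Some i) p' -> exists2 T, emb_must p i T & T p'.
Proof. by move=> Ii h; exists [set p'] => //; exists p'. Qed.

Definition emb Act (I O : set Act) (P : IA I O) : MIA I O :=
  MkMIA (ia_disjoint P) (@emb_must_label _ _ _ P) (@ia_label _ _ _ P)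
    (@emb_must_nonempty _ _ _ P) (@emb_must_may _ _ _ P)
    (@emb_must_input_det _ _ _ P) (@emb_may_input_must _ _ _ P).

Definition emb_st Act (I O : set Act) (P : IA I O) (p : P) : emb P := p.

(* Main.v *)
(** An embedded interface automaton has must-transitions for inputs only, all
    with singleton targets.  Hence in a conjunction of embeddings no state is
    inconsistent: (F1) and (F2) require an output-must, and (F3) alone generates
    nothing.  In a composition of embeddings the two notions of error agree,
    because a shared output of one component is an input of the other, where
    "no must" means "no transition".  So in both cases the identity on
    underlying states is a refinement in either direction; the only
    discrepancy, the weak may-transitions of the MIA-conjunction, is absorbed
    by weak matching. *)

Require Import Defs.
From Stdlib Require Import Relation_Operators.
From mathcomp Require Import all_boot boolp classical_sets.

Set Implicit Arguments.
Unset Strict Implicit.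
Unset Printing Implicit Defensive.

Local Open Scope classical_set_scope.

(** * Weak moves, and must-transitions of embeddings *)

Lemma weak_may_eps Act (I O : set Act) (P : MIA I O) (p p' : P) :
  weak_may p None p' -> weak_eps p p'.
Proof. by case=> x px xp'; apply: rt_trans px _; exact: rt_step. Qed.

Lemma may_weak_hat Act (I O : set Act) (P : MIA I O) (p p' : P) l :
  may p l p' -> weak_may_hat p l p'.
Proof. by case: l => [a|] h; [exact: may_weak | exact: rt_step]. Qed.

Lemma emb_must_enabled Act (I O : set Act) (P : IA I O) (p : P) a :
  I a -> must_enabled (emb_st p) a <-> ia_enabled p a.
Proof.
move=> Ia; split=> [[_ [p' [_ h _]]]|[p' h]]; first by exists p'.
by exists [set p'], p'.
Qed.

Lemma emb_no_output_must Act (I O : set Act) (P : IA I O) (p : P) o T :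
  O o -> ~ must (emb_st p) o T.
Proof. by move=> Oo [p' [Io _ _]]; exact: IO_absurd (ia_disjoint P) Io Oo. Qed.

(** * Conjunction *)

Lemma Cprod_set1 (S T : Type) (x : S) (y : T) :
  Cprod [set x] [set y] = [set Cpair x y].
Proof.
apply/seteqP; split=> [s [u [v [-> -> ->]]] //|s ->].
by exists x, y.
Qed.

Lemma emb_conj_consistent Act (I O : set Act) (P Q : IA I O)
    (s : conj_state (emb P) (emb Q)) : ~ inconsistent s.
Proof.
induction 1 as [p q o Oo [T h]|p q o Oo [T h]|p q a R' h _ IH].
- exact: emb_no_output_must Oo h.
- exact: emb_no_output_must Oo h.
(* The target set of a must-transition is nonempty, and the induction hypothesis refutes each of its
   members. *)
- by case: (cmust_nonempty h) => r /IH.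
Qed.

(** The output rules [OMust1] and [OMust2] are vacuous here, and [IMust1]-[IMust3] mirror the IA
    input rules, because being must-enabled and being enabled agree on inputs. Target sets match
    exactly, since images and products of singletons are singletons. *)
Lemma emb_cmustP Act (I O : set Act) (P Q : IA I O)
    (s : conj_state (emb P) (emb Q)) a R' :
  cmust s a R' <-> @emb_must _ _ _ (ia_conj P Q) s a R'.
Proof.
split.
- case=> {s a R'}.
  + move=> p a _ [p' [Ia h ->]]; exists (Cleft p').
    by rewrite image_set1; split=> //; constructor.
  + move=> q a _ [q' [Ia h ->]]; exists (Cright q').
    by rewrite image_set1; split=> //; constructor.
  + by move=> p q o P' Oo /(emb_no_output_must Oo).
  + by move=> p q o Q' Oo _ /(emb_no_output_must Oo).
  + move=> p q a _ Ia [p' [_ h ->]] /(emb_must_enabled _ Ia) n.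
    by exists (Cleft p'); rewrite image_set1; split=> //; exact: IAC_I1.
  + move=> p q a _ Ia /(emb_must_enabled _ Ia) n [q' [_ h ->]].
    by exists (Cright q'); rewrite image_set1; split=> //; exact: IAC_I2.
  + move=> p q a _ _ Ia [p' [_ h ->]] [q' [_ k ->]].
    exists (Cpair p' q'); rewrite Cprod_set1; split=> //.
    by apply: IAC_I3O => //; left.
- case=> t [Ia + ->]; move El: (Some a) => l h.
  case: h El => {s l t} //.
  + move=> p l p' h El; rewrite -El in h; rewrite -image_set1.
    by apply: CM_left; exists p'.
  + move=> q l q' h El; rewrite -El in h; rewrite -image_set1.
    by apply: CM_right; exists q'.
  + move=> p q b p' _ h n [Eb]; rewrite -Eb in h n; rewrite -image_set1.
    by apply: IMust1 => //; [exists p' | move=> /(emb_must_enabled _ Ia)].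
  + move=> p q b q' _ n h [Eb]; rewrite -Eb in h n; rewrite -image_set1.
    by apply: IMust2 => //; [move=> /(emb_must_enabled _ Ia) | exists q'].
  + move=> p q b p' q' _ h k [Eb]; rewrite -Eb in h k; rewrite -Cprod_set1.
    by apply: IMust3 => //; [exists p' | exists q'].
Qed.

(** Internal steps interleave freely: first those of [p], then those of [q]. *)
Lemma emb_conj_weak_eps Act (I O : set Act) (P Q : IA I O)
    (p p' : emb P) (q q' : emb Q) :
  weak_eps p p' -> weak_eps q q' ->
  weak_eps (emb_st (ia_conj_st p q)) (emb_st (ia_conj_st p' q')).
Proof.
move=> hp hq; apply: (rt_trans _ _ _ (emb_st (ia_conj_st p' q))).
- elim: hp => [x y h|x|x y z _ h1 _ h2].
  + by apply: rt_step; exact: IAC_T1.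
  + exact: rt_refl.
  + exact: rt_trans h1 h2.
- elim: hq => [x y h|x|x y z _ h1 _ h2].
  + by apply: rt_step; exact: IAC_T2.
  + exact: rt_refl.
  + exact: rt_trans h1 h2.
Qed.

(** The weak moves of the two components in the MIA-conjunction are replayed one internal step at a
    time, followed by a joint step if the label is an output. *)
Lemma emb_cmay_weak Act (I O : set Act) (P Q : IA I O)
    (s t : conj_state (emb P) (emb Q)) l :
  in_tau O l -> cmay s l t -> @weak_may_hat _ _ _ (emb (ia_conj P Q)) s l t.
Proof.
move=> + h; case: h => {s l t}.
- by move=> p l p' h _; apply: may_weak_hat; exact: IAC_left.
- by move=> q l q' h _; apply: may_weak_hat; exact: IAC_right.
- move=> p q p' /weak_may_eps h _.
  by apply: emb_conj_weak_eps => //; exact: rt_refl.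
- move=> p q q' /weak_may_eps h _.
  by apply: emb_conj_weak_eps => //; exact: rt_refl.
(* On [tau] the IA-conjunction has no joint step, but interleaving suffices because [weak_may_hat]
   asks only for a [tau]-path. *)
- move=> p q [o|] p' q' /= Ol h k _; last first.
    by apply: emb_conj_weak_eps; exact: weak_may_eps.
  case: h k => x px xp' [y qy yq'].
  exists (emb_st (ia_conj_st x y)); first exact: emb_conj_weak_eps.
  by apply: IAC_I3O => //; right.
- by move=> p q i p' Ii _ _ Oi; case: (IO_absurd (ia_disjoint P) Ii Oi).
- by move=> p q i q' Ii _ _ Oi; case: (IO_absurd (ia_disjoint P) Ii Oi).
- by move=> p q i p' q' Ii _ _ Oi; case: (IO_absurd (ia_disjoint P) Ii Oi).
Qed.

Lemma ia_conj_trans_cmay Act (I O : set Act) (P Q : IA I O)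
    (s t : conj_state P Q) l :
  in_tau O l -> ia_conj_trans s l t -> @cmay _ _ _ (emb P) (emb Q) s l t.
Proof.
move=> + h; case: h => {s l t}.
- by move=> p l p' h _; exact: Cm_left.
- by move=> q l q' h _; exact: Cm_right.
- by move=> p q i p' Ii _ _ Oi; case: (IO_absurd (ia_disjoint P) Ii Oi).
- by move=> p q i q' Ii _ _ Oi; case: (IO_absurd (ia_disjoint P) Ii Oi).
- by move=> p q a p' q' _ h k Oa; apply: May3 => //; exact: may_weak.
- by move=> p q p' h _; apply: May1; exact: may_weak.
- by move=> p q q' h _; apply: May2; exact: may_weak.
Qed.

(** By [emb_conj_consistent] the pruned subtype contains every element of [conj_state], so the graph
    of the projection [sval] serves in both directions. *)
Lemma emb_conj_eq Act (I O : set Act) (P Q : IA I O)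
    (s : mia_conj (emb P) (emb Q)) : mia_eq s (sval s : emb (ia_conj P Q)).
Proof.
split.
- exists (fun u (v : emb (ia_conj P Q)) => sval u = v) => // u _ <-; split.
  + move=> a T h; exists [set t | T (sval t)].
      by exists T => //; apply/emb_cmustP.
    by move=> t ht; exists (sval t).
  + by move=> l t Ol h; exists (sval t) => //; exact: emb_cmay_weak.
- exists (fun (v : emb (ia_conj P Q)) u => v = sval u) => // _ u ->; split.
  + move=> a _ [R' /emb_cmustP h ->]; exists R' => // t ht.
    by exists (exist _ t (@emb_conj_consistent _ _ _ _ _ t)).
  + move=> l t Ol /(ia_conj_trans_cmay Ol) h.
    exists (exist _ t (@emb_conj_consistent _ _ _ _ _ t)) => //.
    exact: may_weak_hat.
Qed.

(** * Parallel composition *)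

Lemma emb_pmayP Act (I1 O1 I2 O2 : set Act) (P : IA I1 O1) (Q : IA I2 O2)
    (s t : emb P * emb Q) l :
  pmay s l t <-> @ia_par_trans _ _ _ _ _ P Q s l t.
Proof.
split; case=> {s l t} *.
- exact: IAP_Par1.
- exact: IAP_Par2.
- by apply: IAP_Par3; eassumption.
- exact: PMay1.
- exact: PMay2.
- by apply: PMay3; eassumption.
Qed.

(** Synchronisation yields [tau], so a visible step belongs to one component whose partner lacks the
    action; the action is then an input of the product exactly when it is an input of that
    component. *)
Lemma emb_pmustP Act (I1 O1 I2 O2 : set Act) (P : IA I1 O1) (Q : IA I2 O2)
    (s : emb P * emb Q) a R' :
  pmust s a R' <->
  exists t, [/\ par_in I1 O1 I2 O2 a, @ia_par_trans _ _ _ _ _ P Q s (Some a) t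
              & R' = [set t]].
Proof.
split.
- move=> h; case: (cid (pmust_nonempty h)) => t ht.
  exists t; split.
  + case: h => {s a R' t ht} p q a X [x [Ia _ _]] n; split.
    * by left.
    * by case=> k; [exact: IO_absurd (ia_disjoint P) Ia k | apply: n; right].
    * by right.
    * by case=> k; [apply: n; right | exact: IO_absurd (ia_disjoint Q) Ia k].
  + by apply/emb_pmayP; exact: pmust_pmay h ht.
  (* The target is a product of two singletons, so its chosen element [t] determines it. *)
  + case: h ht => {s a R'} p q a X [x [_ _ ->]] _;
      by case: t => u v [/= -> ->]; apply/seteqP;
         split=> [[? ?] [/= -> ->]|_ ->].
- case=> t [Ia + ->]; move El: (Some a) => l h.
  case: h El => {s l t} // p q l x h n El; rewrite -El in h n.
  + have -> : [set (x, q)] = [set x] `*` [set q].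
      by apply/seteqP; split=> [_ ->|[? ?] [/= -> ->]].
    by apply: PMust1 => //; exists x; split=> //; exact: par_in1 Ia n.
  + have -> : [set (p, x)] = [set p] `*` [set x].
      by apply/seteqP; split=> [_ ->|[? ?] [/= -> ->]].
    by apply: PMust2 => //; exists x; split=> //; exact: par_in2 Ia n.
Qed.

Lemma emb_mia_error Act (I1 O1 I2 O2 : set Act) (P : IA I1 O1) (Q : IA I2 O2)
    (s : emb P * emb Q) : composable I1 O1 I2 O2 ->
  mia_error s <-> @ia_error _ _ _ _ _ P Q s.
Proof.
case: s => p q comp.
(* By composability a shared action is an input of one side and an output of the other; disjointness
   of each component's alphabets decides which. *)
have in2 a : ((I1 `|` O1) `&` (I2 `|` O2)) a -> O1 a -> I2 a.
  rewrite comp => -[[Ia _]|[_ //]] Oa.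
  by case: (IO_absurd (ia_disjoint P) Ia Oa).
have in1 a : ((I1 `|` O1) `&` (I2 `|` O2)) a -> O2 a -> I1 a.
  rewrite comp => -[[//]|[_ Ia]] Oa.
  by case: (IO_absurd (ia_disjoint Q) Ia Oa).
split=> -[a sh [[Oa e n]|[Oa e n]]]; exists a => //;
  [left|right|left|right]; split=> // k; apply: n.
- by apply/(emb_must_enabled _ (in2 a sh Oa)).
- by apply/(emb_must_enabled _ (in1 a sh Oa)).
- by apply/(emb_must_enabled _ (in2 a sh Oa)).
- by apply/(emb_must_enabled _ (in1 a sh Oa)).
Qed.

Lemma emb_mia_illegal Act (I1 O1 I2 O2 : set Act) (P : IA I1 O1) (Q : IA I2 O2)
    (s : emb P * emb Q) : composable I1 O1 I2 O2 ->
  mia_illegal s <-> @ia_illegal _ _ _ _ _ P Q s.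
Proof.
move=> comp; split; induction 1 as [s e|s l t Ol h _ IH].
- by apply: IAE_error; apply/(emb_mia_error _ comp).
- by apply: IAE_step Ol _ IH; apply/emb_pmayP.
- by apply: ME_error; apply/(emb_mia_error _ comp).
- by apply: ME_step Ol _ IH; apply/emb_pmayP.
Qed.

Lemma emb_par_mustP Act (I1 O1 I2 O2 : set Act) (P : IA I1 O1) (Q : IA I2 O2)
    (s : mia_par (emb P) (emb Q)) a T :
  must s a T <->
  exists t, [/\ par_in I1 O1 I2 O2 a,
                @ia_par_trans _ _ _ _ _ P Q (sval s) (Some a) (sval t)
              & T = [set t]].
Proof.
split.
- move=> h; case: (cid (must_nonempty h)) => t ht; exists t.
  case: h ht => R' [/emb_pmustP [u [Ia h ->]] _ ->] /= Eu.
  split=> //; first by rewrite Eu.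
  by apply/seteqP; split=> [v /= Ev|v ->] //=; apply: sub_inj; rewrite Eu.
- case=> t [Ia h ->]; exists [set sval t]; split.
  + by apply/emb_pmustP; exists (sval t).
  (* Removal would need an illegal source or target, but the only two states involved lie in the
     pruned product. *)
  + case=> _ [/(svalP s) //|[_ -> /(svalP t)] //].
  + by apply/seteqP; split=> [v -> //|v /= Ev]; exact: sub_inj.
Qed.

(** A may-transition is pruned only along with a must-transition above it. That must-transition has
    the singleton target [sval t], which is legal, so it is not removed. *)
Lemma emb_par_mayP Act (I1 O1 I2 O2 : set Act) (P : IA I1 O1) (Q : IA I2 O2)
    (s t : mia_par (emb P) (emb Q)) l :
  may s l t <-> @ia_par_trans _ _ _ _ _ P Q (sval s) l (sval t).
Proof.
split=> [[/emb_pmayP]//|h]; split; first exact/emb_pmayP.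
case=> a [R' [_ [/emb_pmustP [u [_ _ ->]] bad] Eu]].
by case: bad => [/(svalP s) //|[_ ->]]; rewrite -Eu => /(svalP t).
Qed.

(** The two carriers are different subtypes of the same pairs, so states are related when their
    underlying pairs agree. *)
Lemma emb_par_eq Act (I1 O1 I2 O2 : set Act) (P : IA I1 O1) (Q : IA I2 O2)
    (s : mia_par (emb P) (emb Q)) (t : emb (ia_par P Q)) :
  composable I1 O1 I2 O2 -> sval s = sval t -> mia_eq s t.
Proof.
move=> comp Est.
(* [toM] and [toI] transport states between the carriers, using that both notions of illegal state
   coincide. *)
have toM (u : ia_par P Q) :
    exists v : mia_par (emb P) (emb Q), sval v = sval u.
  have nu : ~ @mia_illegal _ _ _ _ _ (emb P) (emb Q) (sval u).
    by move=> /(emb_mia_illegal _ comp) /(svalP u).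
  by exists (exist _ (sval u) nu).
have toI (v : mia_par (emb P) (emb Q)) :
    exists u : emb (ia_par P Q), sval v = sval u.
  have nv : ~ @ia_illegal _ _ _ _ _ P Q (sval v).
    by move=> /(emb_mia_illegal _ comp) /(svalP v).
  by exists (exist _ (sval v) nv).
split.
- exists (fun (v : mia_par (emb P) (emb Q)) (u : emb (ia_par P Q)) =>
            sval v = sval u) => // v u E; split.
  + move=> a _ [u' [Ia h ->]]; have [v' E'] := toM u'.
    exists [set v']; last by move=> _ ->; exists u'.
    apply/emb_par_mustP; exists v'; split=> //.
    by rewrite E E'.
  + move=> l v' _ /emb_par_mayP h; have [u' E'] := toI v'.
    exists u' => //; apply: may_weak_hat.
    by rewrite E E' in h.
- exists (fun (u : emb (ia_par P Q)) (v : mia_par (emb P) (emb Q)) =>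
            sval v = sval u) => // u v E; split.
  + move=> a _ /emb_par_mustP [v' [Ia h ->]]; have [u' E'] := toI v'.
    exists [set u']; last by move=> _ ->; exists v'.
    exists u'; split=> //.
    by rewrite E E' in h.
  + move=> l u' _ h; have [v' E'] := toM u'.
    exists v' => //; apply: may_weak_hat; apply/emb_par_mayP.
    by rewrite E E'.
Qed.

Theorem theorem4p17 :
  (forall (Act : Type) (I O : set Act) (P Q : IA I O) (p : P) (q : Q),
     exists hdef : mia_conj_defined (emb_st p) (emb_st q),
       mia_eq (mia_conj_st hdef) (emb_st (ia_conj_st p q)))
  /\
  (forall (Act : Type) (I1 O1 I2 O2 : set Act)
     (P : IA I1 O1) (Q : IA I2 O2) (p : P) (q : Q),
     composable I1 O1 I2 O2 ->
     forall hpq : ia_compatible p q,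
     exists hcomp : mia_compatible (emb_st p) (emb_st q),
       mia_eq (mia_par_st hcomp) (emb_st (ia_par_st hpq))).
Proof.
split=> [Act I O P Q p q|Act I1 O1 I2 O2 P Q p q comp hpq].
- exists (@emb_conj_consistent _ _ _ _ _ _); exact: emb_conj_eq.
- have hcomp : mia_compatible (emb_st p) (emb_st q).
    by move=> /(emb_mia_illegal _ comp).
  by exists hcomp; exact: emb_par_eq.
Qed.
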